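(* Let $(F,\partial)$ be a differential field of characteristic zero with field of constants $K$, let $G$ be a linear algebraic group over $K$, let $X$ be a $G_F$-torsor, and let $x\in X(\overline{F})$ be a fixed element. The assignment $\partial\mapsto\partial_x$ induces a bijection between the set of derivations $\partial\colon F[X]\to F[X]$ (extending $\partial\colon F\to F$) that endow $X$ with the structure of a differential $G_F$-torsor and the set of point derivations $\widetilde{\partial}\colon F[X]\to\overline{F}$ at $x$ that are Galois-equivariant. In particular, for every derivation $\partial$ on $F[X]$ endowing $X$ with the structure of a differential $G_F$-torsor, $(\partial_x)^y=\partial_y$ for all $y\in X(\overline{F})$.
   Context: A linear algebraic group over $K$ is an affine group scheme of finite type over $K$; $F[G]:=F\otimes_K K[G]$ is a differential ring extension of $F$ in which elements of $K[G]$ are constant. A $G_F$-torsor is a non-empty affine scheme $X$ of finite type over $F$ with a right $G_F$-action such that for every $F$-algebra $R$ and all $x,y\in X(R)$ there is a unique $g\in G(R)$ with $y=x.g$; let $\rho\colon F[X]\to F[X]\otimes_F F[G]=F[X]\otimes_K K[G]$ be the co-action. A derivation on $F[X]$ extending $\partial$ on $F$ endows $X$ with the structure of a differential $G_F$-torsor if $\rho$ is a differential homomorphism. $\overline{F}$ is an algebraic closure of $F$, with the unique extension of $\partial$, and $\Gamma=\mathrm{Gal}(\overline{F}/F)$. For $x\in X(\overline{F})$, a point derivation at $x$ is an additive map $\widetilde{\partial}\colon F[X]\to\overline{F}$ extending $\partial\colon F\to F$ with $\widetilde{\partial}(f_1f_2)=f_1(x)\widetilde{\partial}(f_2)+f_2(x)\widetilde{\partial}(f_1)$.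 For a derivation $\partial\colon F[X]\to F[X]$ extending that of $F$, $\partial_x$ is the point derivation $F[X]\xrightarrow{\partial}F[X]\xrightarrow{x}\overline{F}$ at $x$. Given a point derivation $\widetilde{\partial}$ at $x$ and $y\in X(\overline{F})$, let $g\in G(\overline{F})$ be the unique element with $y=x.g$. Then $\widetilde{\partial}^{\,y}$ is the point derivation at $y$ given by the composition $$F[X]\xrightarrow{\rho}F[X]\otimes_K K[G]\xrightarrow{\widetilde{\partial}\otimes\mathrm{id}}\overline{F}\otimes_K K[G]\xrightarrow{g}\overline{F},$$ where the last map is the $\overline{F}$-algebra map corresponding to $g$. For $\tau\in\Gamma$, $\tau(\widetilde{\partial}):=\tau\circ\widetilde{\partial}$ is a point derivation at $\tau(x)$. The point derivation $\widetilde{\partial}$ at $x$ is called Galois-equivariant if $(\tau(\widetilde{\partial}))^x=\widetilde{\partial}$ for all $\tau\in\Gamma$. *)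

(* Defs.v *)
From HB Require Import structures.
From mathcomp Require Import all_boot all_order all_algebra.
From mathcomp Require Import generic_quotient.
From mathcomp Require Import boolp classical_sets functions.

Set Implicit Arguments.
Unset Strict Implicit.
Unset Printing Implicit Defensive.

Import GRing.Theory.
Local Open Scope ring_scope.
Local Open Scope quotient_scope.

(* Tensor product A (x)_K B of commutative rings, for structure maps
   i : K -> A and j : K -> B.  Its elements are formal sums of pairs (lists),
   two of them being identified when no K-balanced biadditive map to an abelian
   group separates them; this yields the usual universal property ([tliftE],
   [tlift_is_zmod_morphism], [tensor_ext]).  Rings are allowed to be zero. *)

Section TensorGroup.

Variables (K A B : comPzRingType) (i : K -> A) (j : K -> B).

Definition balanced (V : zmodType) (f : A -> B -> V) : Prop :=
  [/\ forall b, zmod_morphism (f^~ b),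
      forall a, zmod_morphism (f a)
    & forall c a b, f (i c * a) b = f a (j c * b)].

Definition eval_sum (V : zmodType) (f : A -> B -> V) (s : seq (A * B)) : V :=
  \sum_(p <- s) f p.1 p.2.

Definition tensor_eq (s t : seq (A * B)) : bool :=
  `[< forall (V : zmodType) (f : A -> B -> V),
        balanced f -> eval_sum f s = eval_sum f t >].

Fact tensor_eq_refl : reflexive tensor_eq.
Proof. by move=> s; apply/asboolP. Qed.

Fact tensor_eq_sym : symmetric tensor_eq.
Proof.
by move=> s t; apply/asboolP/asboolP => E V f bf; rewrite E.
Qed.

Fact tensor_eq_trans : transitive tensor_eq.
Proof.
by move=> t s u /asboolP E1 /asboolP E2; apply/asboolP => V f bf; rewrite E1 ?E2.
Qed.

Canonical tensor_equiv :=
  EquivRel tensor_eq tensor_eq_refl tensor_eq_sym tensor_eq_trans.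

Definition tensor : Type := {eq_quot tensor_equiv}.
HB.instance Definition _ := Choice.on tensor.
HB.instance Definition _ := EqQuotient.on tensor.

Definition tens (a : A) (b : B) : tensor := \pi_tensor [:: (a, b)].

(* The additive map a (x) b |-> f a b; meaningful when f is balanced. *)
Definition tlift (V : zmodType) (f : A -> B -> V) (u : tensor) : V :=
  eval_sum f (repr u).

Lemma tensor_piP s t :
  reflect (forall (V : zmodType) (f : A -> B -> V),
             balanced f -> eval_sum f s = eval_sum f t)
          (\pi_tensor s == \pi_tensor t).
Proof. by rewrite eqmodE; exact: asboolP. Qed.

Lemma tlift_pi V f s : balanced f -> @tlift V f (\pi_tensor s) = eval_sum f s.
Proof.
by move=> bf; apply/tensor_piP => //; apply/eqP; rewrite reprK.
Qed.

Lemma eval_sum_cat V f s t :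
  @eval_sum V f (s ++ t) = eval_sum f s + eval_sum f t.
Proof. exact: big_cat. Qed.

Definition tensor_opp_seq (s : seq (A * B)) := [seq (- p.1, p.2) | p <- s].

Lemma eval_sum_opp V f s : balanced f ->
  @eval_sum V f (tensor_opp_seq s) = - eval_sum f s.
Proof.
move=> [f1 _ _]; rewrite /eval_sum big_map -sumrN; apply: eq_bigr => p _ /=.
have /= f0 := f1 p.2 0 0; rewrite subr0 subrr in f0.
by have /= := f1 p.2 0 p.1; rewrite !sub0r => ->; rewrite f0 sub0r.
Qed.

Definition tensor_add (u v : tensor) : tensor := \pi_tensor (repr u ++ repr v).
Definition tensor_opp (u : tensor) : tensor :=
  \pi_tensor (tensor_opp_seq (repr u)).
Definition tensor_zero : tensor := \pi_tensor [::].

Lemma tensorP (u v : tensor) :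
  (forall (V : zmodType) (f : A -> B -> V),
     balanced f -> tlift f u = tlift f v) -> u = v.
Proof.
move=> E; apply/eqP; rewrite -[u]reprK -[v]reprK; apply/tensor_piP => V f bf.
exact: E.
Qed.

Lemma tlift_add V f u v : balanced f ->
  @tlift V f (tensor_add u v) = tlift f u + tlift f v.
Proof. by move=> bf; rewrite tlift_pi // eval_sum_cat. Qed.

Lemma tlift_opp V f u : balanced f ->
  @tlift V f (tensor_opp u) = - tlift f u.
Proof. by move=> bf; rewrite tlift_pi // eval_sum_opp. Qed.

Lemma tlift_zero V f : balanced f -> @tlift V f tensor_zero = 0.
Proof. by move=> bf; rewrite tlift_pi // /eval_sum big_nil. Qed.

Fact tensor_addA : associative tensor_add.
Proof.
by move=> u v w; apply: tensorP => V f bf; rewrite !tlift_add // addrA.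
Qed.

Fact tensor_addC : commutative tensor_add.
Proof.
by move=> u v; apply: tensorP => V f bf; rewrite !tlift_add // addrC.
Qed.

Fact tensor_add0 : left_id tensor_zero tensor_add.
Proof.
by move=> u; apply: tensorP => V f bf; rewrite tlift_add // tlift_zero // add0r.
Qed.

Fact tensor_addN : left_inverse tensor_zero tensor_opp tensor_add.
Proof.
move=> u; apply: tensorP => V f bf.
by rewrite tlift_add // tlift_opp // tlift_zero // addNr.
Qed.

HB.instance Definition _ := GRing.isZmodule.Build tensor
  tensor_addA tensor_addC tensor_add0 tensor_addN.

Lemma tliftD V f u v : balanced f -> @tlift V f (u + v) = tlift f u + tlift f v.
Proof. exact: tlift_add. Qed.

Lemma tlift0 V f : balanced f -> @tlift V f 0 = 0.
Proof. exact: tlift_zero. Qed.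

Lemma tliftE V f a b : balanced f -> @tlift V f (tens a b) = f a b.
Proof. by move=> bf; rewrite tlift_pi // /eval_sum big_seq1. Qed.

Lemma tlift_is_zmod_morphism V f :
  balanced f -> zmod_morphism (@tlift V f).
Proof. by move=> bf u v; rewrite tlift_add // tlift_opp. Qed.

Lemma tens_balanced : balanced tens.
Proof.
split=> [b a a' | a b b' | c a b]; apply: tensorP => V f bf;
  have [f1 f2 f3] := bf.
- by rewrite tlift_is_zmod_morphism // !tliftE // f1.
- by rewrite tlift_is_zmod_morphism // !tliftE // f2.
- by rewrite !tliftE // f3.
Qed.

Lemma tlift_sum V f (I : Type) (r : seq I) (F : I -> tensor) : balanced f ->
  @tlift V f (\sum_(x <- r) F x) = \sum_(x <- r) tlift f (F x).
Proof.
move=> bf; elim: r => [|x r IH]; first by rewrite !big_nil tlift_zero.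
by rewrite !big_cons tlift_add // IH.
Qed.

Lemma tensor_sumE (u : tensor) : u = \sum_(p <- repr u) tens p.1 p.2.
Proof.
apply: tensorP => V f bf; rewrite tlift_sum //.
by apply: eq_bigr => p _; rewrite tliftE.
Qed.

Lemma tensor_ind (P : tensor -> Prop) :
  P 0 -> (forall a b u, P u -> P (tens a b + u)) -> forall u, P u.
Proof.
move=> P0 PD u; rewrite [u]tensor_sumE; elim: (repr u) => [|p s IH].
  by rewrite big_nil.
by rewrite big_cons; apply: PD.
Qed.

Lemma tensor_ext (V : zmodType) (h h' : tensor -> V) :
  zmod_morphism h -> zmod_morphism h' ->
  (forall a b, h (tens a b) = h' (tens a b)) -> h =1 h'.
Proof.
move=> hB h'B E u.
have z (k : tensor -> V) : zmod_morphism k ->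
    (k 0 = 0) * (forall u v, k (u + v) = k u + k v).
  move=> kB; have k0 := kB 0 0; rewrite !subrr in k0.
  split=> // v w; have := kB 0 w; rewrite k0 !sub0r => kN.
  by have := kB v (- w); rewrite !opprK kN opprK.
elim/tensor_ind: u => [|a b u IH]; first by rewrite !z.
by rewrite !(z _ hB) !(z _ h'B) E IH.
Qed.

End TensorGroup.

Section TensorRing.

Variables (K A B : comPzRingType) (i : K -> A) (j : K -> B).
Local Notation T := (tensor i j).
Local Notation tens := (tens i j).

Definition tensor_mul (u v : T) : T :=
  tlift (fun a b => tlift (fun a' b' => tens (a * a') (b * b')) v) u.

Definition tensor_one : T := tens 1 1.

Let bt := tens_balanced i j.

Lemma tens_mul_balanced a b :
  balanced i j (fun a' b' => tens (a * a') (b * b')).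
Proof.
have [t1 t2 t3] := bt; split=> [b' x y | a' x y | c x y] /=.
- by rewrite mulrBr t1.
- by rewrite mulrBr t2.
- by rewrite mulrCA t3 [b * (_ * _)]mulrCA.
Qed.

Lemma tensor_mul_balanced (v : T) :
  balanced i j (fun a b => tlift (fun a' b' => tens (a * a') (b * b')) v).
Proof.
have [t1 t2 t3] := bt; have m := tens_mul_balanced.
split=> [b x y | a x y | c x y] /=; rewrite /tlift /eval_sum -?sumrB;
  apply: eq_bigr => p _.
- by rewrite mulrBl t1.
- by rewrite mulrBl t2.
- by rewrite -!mulrA t3.
Qed.

Fact tensor_mulE a b a' b' :
  tensor_mul (tens a b) (tens a' b') = tens (a * a') (b * b').
Proof.
rewrite /tensor_mul tliftE; last exact: tensor_mul_balanced.
by rewrite tliftE //; exact: tens_mul_balanced.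
Qed.

Fact tensor_mulBl (v : T) : zmod_morphism (tensor_mul^~ v).
Proof. exact: (tlift_is_zmod_morphism (tensor_mul_balanced v)). Qed.

Fact tensor_mulDl : left_distributive tensor_mul +%R.
Proof.
by move=> u v w; exact: (tlift_add u v (tensor_mul_balanced w)).
Qed.

Fact tensor_mul0 u : tensor_mul 0 u = 0.
Proof. exact: (tlift_zero (tensor_mul_balanced u)). Qed.

Fact tensor_mulC : commutative tensor_mul.
Proof.
have D u v w : tensor_mul u (v + w) = tensor_mul u v + tensor_mul u w.
  rewrite /tensor_mul /tlift /eval_sum -big_split; apply: eq_bigr => p _ /=.
  exact: (tlift_add v w (tens_mul_balanced p.1 p.2)).
have z u : tensor_mul u 0 = 0.
  rewrite /tensor_mul /tlift /eval_sum big1 // => p _.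
  exact: (tlift_zero (tens_mul_balanced p.1 p.2)).
move=> u v; elim/tensor_ind: u => [|a b u IH]; first by rewrite z tensor_mul0.
rewrite D tensor_mulDl IH; congr (_ + _).
elim/tensor_ind: v {IH} => [|a' b' v IH]; first by rewrite z tensor_mul0.
by rewrite D tensor_mulDl IH !tensor_mulE [a * _]mulrC [b * _]mulrC.
Qed.

Fact tensor_mulA : associative tensor_mul.
Proof.
have D u v w : tensor_mul u (v + w) = tensor_mul u v + tensor_mul u w.
  by rewrite tensor_mulC tensor_mulDl !(tensor_mulC u).
have z u : tensor_mul u 0 = 0 by rewrite tensor_mulC tensor_mul0.
move=> u v w; elim/tensor_ind: u => [|a b u IH]; first by rewrite !tensor_mul0.
rewrite !tensor_mulDl IH; congr (_ + _).
elim/tensor_ind: v {IH} => [|a' b' v IH]; first by rewrite ?(tensor_mul0, z).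
rewrite !(D, tensor_mulDl) IH; congr (_ + _).
elim/tensor_ind: w {IH} => [|a'' b'' w IH]; first by rewrite !z.
by rewrite !D IH !tensor_mulE !mulrA.
Qed.

Fact tensor_mul1 : left_id tensor_one tensor_mul.
Proof.
have D u v w : tensor_mul u (v + w) = tensor_mul u v + tensor_mul u w.
  by rewrite tensor_mulC tensor_mulDl !(tensor_mulC u).
move=> u; elim/tensor_ind: u => [|a b u IH].
  by rewrite tensor_mulC tensor_mul0.
by rewrite D IH tensor_mulE !mul1r.
Qed.

HB.instance Definition _ := GRing.Zmodule_isComPzRing.Build T
  tensor_mulA tensor_mulC tensor_mul1 tensor_mulDl.

Lemma tensM a b a' b' : tens a b * tens a' b' = tens (a * a') (b * b').
Proof. exact: tensor_mulE. Qed.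

Lemma tens11 : tens 1 1 = 1. Proof. by []. Qed.

Definition tens_inl (a : A) : T := tens a 1.

(* The ring map a (x) b |-> f a * g b. *)
Definition copair (R : comPzRingType) (f : A -> R) (g : B -> R) : T -> R :=
  tlift (fun a b => f a * g b).

Section Copair.

Variables (R : comPzRingType) (f : {rmorphism A -> R}) (g : {rmorphism B -> R}).
Hypothesis fg : f \o i =1 g \o j.

Lemma copair_balanced : balanced i j (fun a b => f a * g b).
Proof.
split=> [b x y | a x y | c a b] /=; rewrite ?rmorphB ?mulrBl ?mulrBr //.
by rewrite !rmorphM; have /= -> := fg c; rewrite mulrAC mulrC mulrA mulrAC.
Qed.

Lemma copairE a b : copair f g (tens a b) = f a * g b.
Proof. by rewrite /copair tliftE //; exact: copair_balanced. Qed.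

Lemma copair_is_zmod_morphism : zmod_morphism (copair f g).
Proof. exact/tlift_is_zmod_morphism/copair_balanced. Qed.

Lemma copair_is_monoid_morphism : monoid_morphism (copair f g).
Proof.
have bf := copair_balanced.
split=> [|u v]; first by rewrite copairE !rmorph1 mulr1.
rewrite /copair; elim/tensor_ind: u => [|a b u IH].
  by rewrite mul0r tlift0 // mul0r.
rewrite mulrDl !(tliftD _ _ bf) IH mulrDl; congr (_ + _).
elim/tensor_ind: v {IH} => [|a' b' v IH]; first by rewrite mulr0 tlift0 // mulr0.
by rewrite mulrDr tensM !(tliftD _ _ bf) IH mulrDr !tliftE // !rmorphM mulrACA.
Qed.

End Copair.

End TensorRing.

(* The additive map f (x) g; meaningful when f and g are additive and linear
   over K. *)
Definition tmap (K A B A' B' : comPzRingType)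
    (i : K -> A) (j : K -> B) (i' : K -> A') (j' : K -> B')
    (f : A -> A') (g : B -> B') : tensor i j -> tensor i' j' :=
  tlift (fun a b => tens i' j' (f a) (g b)).

Arguments tmap {K A B A' B' i j i' j'} f g u.

Section Tmap.

Variables (K A B A' B' : comPzRingType).
Variables (i : K -> A) (j : K -> B) (i' : K -> A') (j' : K -> B').
Variables (f : A -> A') (g : B -> B').
Hypotheses (fB : zmod_morphism f) (gB : zmod_morphism g).
Hypothesis fZ : forall c a, f (i c * a) = i' c * f a.
Hypothesis gZ : forall c b, g (j c * b) = j' c * g b.

Lemma tmap_balanced : balanced i j (fun a b => tens i' j' (f a) (g b)).
Proof.
have [t1 t2 t3] := tens_balanced i' j'.
split=> [b x y | a x y | c a b] /=.
- by rewrite fB t1.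
- by rewrite gB t2.
- by rewrite fZ gZ t3.
Qed.

Lemma tmap_tens a b : tmap f g (tens i j a b) = tens i' j' (f a) (g b).
Proof. exact: (tliftE _ _ tmap_balanced). Qed.

Lemma tmap_is_zmod_morphism :
  zmod_morphism (tmap f g : tensor i j -> tensor i' j').
Proof. exact: (tlift_is_zmod_morphism tmap_balanced). Qed.

End Tmap.

(* k-algebra homomorphisms from A to the (possibly zero) commutative k-algebra R
   with structure map s : k -> R, i.e. the R-points of Spec A. *)
Record algHom (k : comPzRingType) (A : comAlgType k) (R : comPzRingType)
    (s : k -> R) := AlgHom {
  algHom_fun :> {rmorphism A -> R};
  algHomE : forall c, algHom_fun (c%:A) = s c }.

Definition finite_type (k : fieldType) (A : comAlgType k) : Prop :=
  exists r : seq A, forall S : {pred A},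
    subalg_closed S -> {subset r <= S} -> forall a, a \in S.

(* The product of two points of a monoid scheme with comultiplication Delta. *)
Definition conv (K : comPzRingType) (H : comAlgType K) (R : comPzRingType)
    (Delta : H -> tensor (in_alg H) (in_alg H)) (g h : H -> R) : H -> R :=
  copair g h \o Delta.

(* An affine group scheme of finite type over K is given by its coordinate ring
   H = K[G] and by K-algebra maps inducing a group structure on
   G(R) = Hom_{K-alg}(K[G], R) for every commutative K-algebra R. *)
Record linear_algebraic_group (K : fieldType) := LinearAlgebraicGroup {
  gring : comAlgType K;
  gring_finite_type : finite_type gring;
  comul : algHom gring
            (tens_inl (in_alg gring) (in_alg gring) \o in_alg gring);
  counit : algHom gring (@idfun K);
  antipode : algHom gring (in_alg gring);
  conv_assoc : forall (R : comPzRingType) (s : {rmorphism K -> R})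
      (g h l : algHom gring s),
    conv comul (conv comul g h) l =1 conv comul g (conv comul h l);
  conv_unitl : forall (R : comPzRingType) (s : {rmorphism K -> R})
      (g : algHom gring s), conv comul (s \o counit) g =1 g;
  conv_unitr : forall (R : comPzRingType) (s : {rmorphism K -> R})
      (g : algHom gring s), conv comul g (s \o counit) =1 g;
  conv_invl : forall (R : comPzRingType) (s : {rmorphism K -> R})
      (g : algHom gring s), conv comul (g \o antipode) g =1 s \o counit;
  conv_invr : forall (R : comPzRingType) (s : {rmorphism K -> R})
      (g : algHom gring s), conv comul g (g \o antipode) =1 s \o counit }.

Section Torsor.

Variables (K F : fieldType) (kappa : {rmorphism K -> F}).
Variable G : linear_algebraic_group K.
Local Notation H := (gring G).

(* F[X] (x)_F F[G] = F[X] (x)_K K[G] *)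
Definition coact_ring (A : comAlgType F) : comPzRingType :=
  tensor (in_alg A \o kappa) (in_alg H).

(* x.g *)
Definition act (A : comAlgType F) (rho : A -> coact_ring A) (R : comPzRingType)
    (x : A -> R) (g : H -> R) : A -> R :=
  copair x g \o rho.

(* A comAlgType is a nonzero ring, so that X is non-empty.  For an F-algebra R
   with structure map s, one has G_F(R) = G(R) = Hom_{K-alg}(K[G], R). *)
Record torsor := Torsor {
  xring : comAlgType F;
  xring_finite_type : finite_type xring;
  coact : algHom xring
    (tens_inl (in_alg xring \o kappa) (in_alg H) \o in_alg xring);
  act_unit : forall (R : comPzRingType) (s : {rmorphism F -> R})
      (x : algHom xring s),
    act coact x (s \o kappa \o counit G) =1 x;
  act_conv : forall (R : comPzRingType) (s : {rmorphism F -> R})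
      (x : algHom xring s) (g h : algHom H (s \o kappa)),
    act coact (act coact x g) h =1 act coact x (conv (comul G) g h);
  act_simply_transitive : forall (R : comPzRingType) (s : {rmorphism F -> R})
      (x y : algHom xring s),
    exists g : algHom H (s \o kappa), y =1 act coact x g /\
      forall g' : algHom H (s \o kappa), y =1 act coact x g' -> g' =1 g }.

(* The unique g with y = x.g. *)
Definition tdiv (X : torsor) (R : comPzRingType) (s : {rmorphism F -> R})
    (x y : algHom (xring X) s) : algHom H (s \o kappa) :=
  sval (cid (act_simply_transitive x y)).

End Torsor.

Definition is_derivation (R : comPzRingType) (D : R -> R) : Prop :=
  zmod_morphism D /\ forall a b, D (a * b) = D a * b + a * D b.

Section Differential.

Variables (K F : fieldType) (kappa : {rmorphism K -> F}) (d : F -> F).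
Variables (G : linear_algebraic_group K) (X : torsor kappa G).
Local Notation A := (xring X).
Local Notation H := (gring G).

(* As the elements of K[G] are constant, the derivation of
   F[X] (x)_K K[G] is D (x) id. *)
Definition differential_torsor (D : A -> A) : Prop :=
  [/\ is_derivation D,
      forall a : F, D (a%:A) = (d a)%:A
    & forall f, coact X (D f) = tmap D idfun (coact X f)].

Variables (Fbar : closedFieldType) (iota : {rmorphism F -> Fbar}).

Definition point_derivation (x : algHom A iota) (dt : A -> Fbar) : Prop :=
  [/\ zmod_morphism dt,
      forall a : F, dt (a%:A) = iota (d a)
    & forall f1 f2, dt (f1 * f2) = x f1 * dt f2 + x f2 * dt f1].

(* For a point derivation dt at x, the point derivation dt^y at y. *)
Definition transport (x y : algHom A iota) (dt : A -> Fbar) : A -> Fbar :=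
  copair idfun (tdiv x y) \o
  (tmap dt idfun : coact_ring kappa G A -> tensor (iota \o kappa) (in_alg H)) \o
  coact X.

Record galois := Galois {
  galois_fun :> {rmorphism Fbar -> Fbar};
  galois_bij : bijective galois_fun;
  galois_fix : forall a, galois_fun (iota a) = iota a }.

Fact galois_point_subproof (tau : galois) (x : algHom A iota) (c : F) :
  (tau \o x) (c%:A) = iota c.
Proof. by rewrite /= algHomE galois_fix. Qed.

Definition galois_point (tau : galois) (x : algHom A iota) : algHom A iota :=
  @AlgHom _ _ _ _ (tau \o x) (galois_point_subproof tau x).

Definition galois_equivariant (x : algHom A iota) (dt : A -> Fbar) : Prop :=
  forall tau : galois, transport (galois_point tau x) x (tau \o dt) =1 dt.

End Differential.

(* Main.v *)
Require Import Defs.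
From HB Require Import structures.
From mathcomp Require Import all_boot all_order all_algebra.
From mathcomp Require Import ring.
From mathcomp Require Import boolp classical_sets functions.

Set Implicit Arguments.
Unset Strict Implicit.
Unset Printing Implicit Defensive.

Import GRing.Theory.
Local Open Scope ring_scope.
Local Open Scope classical_set_scope.

(** Put B = Fbar (x)_K K[G]. Acting on x by the universal point of G gives
    phi = (x (x) id) o rho : F[X] -> B, and the torsor property says that phi
    extends to an isomorphism F[X] (x)_F Fbar -> B (twist, with inverse untwist).
    A point derivation dt at x likewise gives theta = (dt (x) id) o rho, and
    compatibility of D with rho and with dt = x o D forces phi o D = theta. As phi
    is injective, D is unique. Conversely, for tau in Gal(Fbar/F) with
    x = tau(x).g, the tau-semilinear endomorphism of B given by left translation
    by g fixes phi(f), and it fixes theta(f) exactly because dt is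
    Galois-equivariant; under untwist it becomes id (x) tau, so theta(f) descends
    to an element phi(D f). Coassociativity then shows that D commutes with rho.
    In characteristic zero the descent is an average over the finite Galois orbit
    of a tuple of elements of Fbar. *)

(** * Automorphisms of an algebraic closure *)

(* The kernel of t is a maximal subspace avoiding 1. *)
Lemma linear_retraction (F L : fieldType) (iota : {rmorphism F -> L}) :
  exists t : L -> F,
    [/\ zmod_morphism t, forall c z, t (iota c * z) = c * t z & t 1 = 1].
Proof.
pose P (W : set L) :=
  (forall u v c, W u -> W v -> W (u - iota c * v)) /\ ~ W 1.
have [C CP totC|W [[WB W1] Wmax]] := @Zorn_bigcup L P.
  split=> [u v c [S CS Su] [S' CS' S'v]|[S CS S1]]; last by case: (CP _ CS).
  have [/(_ _ Su) S'u|/(_ _ S'v) Sv] := totC _ _ CS CS'.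
    by exists S' => //; apply: (CP _ CS').1.
  by exists S => //; apply: (CP _ CS).1.
(* The property [P] admits the empty set because the empty chain has empty union. Maximality
   excludes it, since {0} would be strictly larger. *)
have W0 : W 0.
  apply: contrapT => nW0.
  have W_empty u : ~ W u.
    by move=> Wu; apply: nW0; have := WB _ _ 1 Wu Wu; rewrite rmorph1 mul1r subrr.
  apply: (Wmax [set 0]); last first.
    split=> [u v c -> -> /=|/=]; first by rewrite mulr0 subr0.
    by apply/eqP; rewrite oner_eq0.
  by split=> [u /W_empty//|/(_ 0 erefl)//].
have decomp z : exists c, W (z - iota c).
  have [Wz|nWz] := pselect (W z); first by exists 0; rewrite rmorph0 subr0.
  (* [W'] is the span of [W] and [z], strictly larger than [W], so maximality puts 1 in it; as 1 is
     not in [W], the coefficient [c] is nonzero and can be inverted. *)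
  pose W' := [set u | exists c, W (u - iota c * z)].
  have [c Wc] : W' 1.
    apply: contrapT => nW'1; apply: (Wmax W'); last first.
      split=> // u v c [a Wa] [b Wb]; exists (a - c * b).
      have := WB _ _ c Wa Wb; congr (W _).
      by rewrite rmorphB rmorphM; ring.
    split=> [u Wu|W'W]; first by exists 0; rewrite rmorph0 mul0r subr0.
    by apply/nWz/W'W; exists 1; rewrite rmorph1 mul1r subrr.
  have c0 : c != 0 by apply/eqP => c0; apply: W1; rewrite c0 rmorph0 mul0r subr0 in Wc.
  exists c^-1; have := WB _ _ c^-1 W0 Wc; congr (W _).
  by rewrite mulrBr mulr1 mulrA -rmorphM mulVf // rmorph1 mul1r sub0r opprB.
(* Two distinct values would put a nonzero scalar into [W], hence also 1. *)
have unique c z c' : W (z - iota c) -> W (z - iota c') -> c = c'.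
  move=> Wc Wc'; apply: contrapT => /eqP; rewrite -subr_eq0 => ne.
  apply: W1; have := WB _ _ (- (c - c')^-1) W0 (WB _ _ 1 Wc' Wc).
  congr (W _); rewrite rmorph1 mul1r sub0r rmorphN mulNr opprK.
  have -> : z - iota c' - (z - iota c) = iota (c - c') by rewrite rmorphB; ring.
  by rewrite -rmorphM mulVf ?rmorph1.
pose t z := sval (cid (decomp z)).
have tP z : W (z - iota (t z)) by rewrite /t; case: cid.
have WZ c u : W u -> W (iota c * u).
  by move=> Wu; have := WB _ _ (- c) W0 Wu; rewrite sub0r rmorphN mulNr opprK.
exists t; split=> [u v|c z|].
- apply: (unique _ (u - v)) => //; have := WB _ _ 1 (tP u) (tP v).
  by congr (W _); rewrite rmorph1 rmorphB; ring.
- apply: (unique _ (iota c * z)) => //; have := WZ c _ (tP z).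
  by rewrite mulrBr rmorphM.
- by apply: (unique _ 1) => //; rewrite rmorph1 subrr.
Qed.

(** Take [p] of least size among the nonzero polynomials vanishing at [z]; the remainder of [q]
    modulo [p] vanishes at [z] too and is smaller, hence zero. *)
Lemma annihilating_generator (E L : fieldType) (a : {rmorphism E -> L}) (z : L) :
  algebraicOver a z -> exists p : {poly E}, [/\ p != 0, root (map_poly a p) z
    & forall q, root (map_poly a q) z -> p %| q].
Proof.
move=> [p0 p0_nz p0z].
pose P n := `[< exists p, [/\ p != 0, root (map_poly a p) z & size p = n] >].
have exP : exists n, P n by exists (size p0); apply/asboolP; exists p0.
case: (ex_minnP exP) => n /asboolP[p [p_nz pz sp]] n_min.
exists p; split=> // q qz; rewrite /dvdp; apply/negPn/negP => r_nz.
have: P (size (q %% p)).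
  apply/asboolP; exists (q %% p); split => //.
  move: qz; rewrite {1}(divp_eq q p) rmorphD rmorphM !rootE hornerD hornerM.
  by rewrite (eqP pz) mulr0 add0r.
by move/n_min; rewrite leqNgt -sp ltn_modp p_nz.
Qed.

(** * Partial homomorphisms as graphs *)

Section PartialAutomorphisms.

Variables (F L : fieldType) (iota : {rmorphism F -> L}).
Hypothesis L_algebraic : forall z : L, algebraicOver iota z.

(* Graphs of F-algebra homomorphisms from a subfield of L to L. *)
Definition partial_hom (S : set (L * L)) : Prop :=
  [/\ forall c, S (iota c, iota c),
      forall u v, S u -> S v -> S (u - v),
      forall u v, S u -> S v -> S (u * v)
    & forall b, S (0, b) -> b = 0].

Lemma maximal_partial_hom (S0 : set (L * L)) : partial_hom S0 ->
  exists S, [/\ partial_hom S, S0 `<=` S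
    & forall S', partial_hom S' -> S `<=` S' -> S' `<=` S].
Proof.
move=> S0P; have [S0F _ _ _] := S0P.
(* The containment of [S0] is required of nonempty sets only, so that the union of the empty chain
   still satisfies [P]. *)
pose P (S : set (L * L)) := (S !=set0 -> S0 `<=` S) /\
  [/\ forall u v, S u -> S v -> S (u - v),
      forall u v, S u -> S v -> S (u * v)
    & forall b, S (0, b) -> b = 0].
have [C CP totC|S [[S0S [SB SM S1]] Smax]] := @Zorn_bigcup (L * L)%type P.
  have both u v : (\bigcup_(X in C) X) u -> (\bigcup_(X in C) X) v ->
      exists S, [/\ C S, S u & S v].
    move=> [S CS Su] [S' CS' S'v].
    have [/(_ _ Su) S'u|/(_ _ S'v) Sv] := totC _ _ CS CS'.
      by exists S'.
    by exists S.
  split=> [[u [S CS Su]] v S0v|].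
    by exists S => //; apply: (CP _ CS).1 => //; exists u.
  split=> [u v Cu Cv|u v Cu Cv|b [S CS]]; last by have [_ [_ _]] := CP _ CS; apply.
    have [S [CS Su Sv]] := both _ _ Cu Cv; exists S => //.
    by have [_ [SB _ _]] := CP _ CS; apply: SB.
  have [S [CS Su Sv]] := both _ _ Cu Cv; exists S => //.
  by have [_ [_ SM _]] := CP _ CS; apply: SM.
have PP S' : partial_hom S' -> S0 `<=` S' -> P S' by move=> [].
have sub : S0 `<=` S.
  apply: S0S; apply: contrapT => S_empty; apply: (Smax S0); last exact: PP.
  have nS u : ~ S u by move=> Su; apply: S_empty; exists u.
  by split=> [u /nS//|/(_ _ (S0F 0))/nS].
exists S; split=> //; first by split=> // c; apply/sub/S0F.
move=> S' S'P SS'; apply: contrapT => nS'S; apply: (Smax S') => //.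
by apply: PP => // u /sub/SS'.
Qed.

(** Factors ['X] are stripped from an annihilating polynomial until its constant term [c] is
    nonzero; then z p(z) = -c, and dividing by -c gives the inverse. *)
Lemma algebraic_inverse (z : L) : z != 0 ->
  exists q : {poly F}, z * (map_poly iota q).[z] = 1.
Proof.
move=> z0; have [p] := L_algebraic z; elim/poly_ind: p => [|p c IH].
  by rewrite eqxx.
move=> p_nz; rewrite rootE rmorphD rmorphM /= map_polyX map_polyC /= hornerMXaddC.
have [c0|c_nz] := eqVneq c 0; last first.
  move=> E; exists (- c^-1 *: p).
  rewrite map_polyZ hornerZ rmorphN fmorphV mulrCA mulNr [z * _]mulrC.
  by move/eqP: E => /eqP; rewrite addr_eq0 => /eqP ->;
    rewrite mulrN opprK mulVf ?fmorph_eq0.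
rewrite c0 rmorph0 addr0 mulf_eq0 (negPf z0) orbF => pz; apply: IH => //.
by apply: contraNneq p_nz => ->; rewrite mul0r c0 addr0.
Qed.

Lemma partial_homX S u (p : {poly F}) : partial_hom S -> S u ->
  S ((map_poly iota p).[u.1], (map_poly iota p).[u.2]).
Proof.
move=> [SF SB SM _] Su; elim/poly_ind: p => [|p c IH].
  by rewrite rmorph0 !horner0; have := SF 0; rewrite rmorph0.
rewrite rmorphD rmorphM /= map_polyX map_polyC /= !hornerMXaddC.
have := SB _ _ (SM _ _ IH Su) (SB _ _ (SF 0) (SF c)); congr (S _).
by congr (_, _); rewrite /= rmorph0 sub0r opprK.
Qed.

Lemma partial_homV S u : partial_hom S -> S u -> u != 0 ->
  exists v, S v /\ v * u = 1.
Proof.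
move=> SP Su u0; have [SF SB SM S1] := SP.
have u1 : u.1 != 0.
  by apply: contraNneq u0 => u1; case: u u1 Su => a b /= -> /S1 ->.
have [q qE] := algebraic_inverse u1.
have Sq := partial_homX q SP Su; eexists; split; first exact: Sq.
(* The pair [u * (q(u.1), q(u.2)) - 1] lies in [S] and has first entry 0, so its second entry is 0
   as well. *)
have qE2 : u.2 * (map_poly iota q).[u.2] = 1.
  apply/eqP; rewrite -subr_eq0; apply/eqP/S1.
  have := SB _ _ (SM _ _ Su Sq) (SF 1); congr (S _).
  by congr (_, _); rewrite /= rmorph1 ?qE ?subrr.
by apply: injective_projections; rewrite /= mulrC.
Qed.

Section GraphField.

Variables (S : set (L * L)) (S_hom : partial_hom S).

(* The [using] attributes keep the proofs as arguments, so that the field structure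
   below can be inferred from the type. *)
#[using="S_hom"]
Definition graph_pred : {pred L * L} := fun u => `[< S u >].

Lemma graph_subring_closed : GRing.subring_closed graph_pred.
Proof.
have [SF SB SM _] := S_hom; split.
- by apply/asboolP; have := SF 1; rewrite rmorph1.
- by move=> u v /asboolP Su /asboolP Sv; apply/asboolP/SB.
- by move=> u v /asboolP Su /asboolP Sv; apply/asboolP/SM.
Qed.

HB.instance Definition _ :=
  GRing.isSubringClosed.Build (L * L)%type graph_pred graph_subring_closed.

#[using="L_algebraic S_hom"]
Definition graph_field := {u | u \in graph_pred}.
HB.instance Definition _ := SubChoice.on graph_field.
HB.instance Definition _ := [SubChoice_isSubComNzRing of graph_field by <:].

(** The second clause fixes the inverse of 0 to be 0, as the field structure demands. *)
Lemma graph_field_inverse (u : graph_field) :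
  exists v : graph_field, (u != 0 -> v * u = 1) /\ (u = 0 -> v = 0).
Proof.
have [->|u0] := eqVneq u 0; first by exists 0.
have [|v [Sv vu]] := partial_homV S_hom (asboolW (valP u)).
  by move: u0; rewrite -(inj_eq val_inj).
have gv : v \in graph_pred by apply/asboolP.
exists (exist _ v gv); split=> [_|/eqP]; last by rewrite ?(negPf u0).
by apply: val_inj; rewrite rmorphM rmorph1.
Qed.

Definition graph_inv (u : graph_field) : graph_field :=
  sval (cid (graph_field_inverse u)).

Lemma graph_mulVf (u : graph_field) : u != 0 -> graph_inv u * u = 1.
Proof. exact: (svalP (cid (graph_field_inverse u))).1. Qed.

Lemma graph_inv0 : graph_inv 0 = 0.
Proof. exact: (svalP (cid (graph_field_inverse 0))).2. Qed.

HB.instance Definition _ :=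
  GRing.ComNzRing_isField.Build graph_field graph_mulVf graph_inv0.

End GraphField.

End PartialAutomorphisms.

(** This is the extension of a(e) -> b(e) that sends [v] to [w]; the hypothesis on roots says
    exactly that it is well defined. *)
Lemma adjoin_partial_hom (F L : fieldType) (iota : {rmorphism F -> L})
    (E : fieldType) (a b : {rmorphism E -> L}) (v w : L) :
  (forall c, exists e, a e = iota c /\ b e = iota c) ->
  (forall q, root (map_poly a q) v -> root (map_poly b q) w) ->
  partial_hom iota
    (range (fun q : {poly E} => ((map_poly a q).[v], (map_poly b q).[w]))).
Proof.
move=> abF vw; split=> [c|u1 u2 [p _ <-] [q _ <-]|u1 u2 [p _ <-] [q _ <-]|y [q _ []]].
- have [e [ae be]] := abF c; exists e%:P => //.
  by rewrite !map_polyC /= !hornerC ae be.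
- by exists (p - q) => //; congr (_, _); rewrite rmorphB hornerD hornerN.
- by exists (p * q) => //; congr (_, _); rewrite rmorphM hornerM.
- by move=> /eqP/vw/eqP qw <-.
Qed.

(** * Extension to automorphisms, and the fixed field *)

Section Automorphisms.

Variables (F : fieldType) (Fbar : closedFieldType) (iota : {rmorphism F -> Fbar}).
Hypothesis Fbar_algebraic : forall z : Fbar, algebraicOver iota z.

(** The graph [S] is itself a field [E] with two projections to [Fbar]. The minimal polynomial of
    [v] along the first has a root [w] along the second; adjoining (v, w) enlarges [S], so by
    maximality the pair was already there. *)
Lemma maximal_partial_hom_total (S : set (Fbar * Fbar)) :
  partial_hom iota S ->
  (forall S', partial_hom iota S' -> S `<=` S' -> S' `<=` S) ->
  forall v, exists w, S (v, w).
Proof.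
move=> S_hom S_max v; have [SF _ _ _] := S_hom.
pose E : fieldType := graph_field Fbar_algebraic S_hom.
pose a : {rmorphism E -> Fbar} := fst \o val.
pose b : {rmorphism E -> Fbar} := snd \o val.
have diag c : (iota c, iota c) \in graph_pred S_hom by apply/asboolP.
pose j c : E := exist (fun u => u \in graph_pred S_hom) _ (diag c).
have j0 : j 0 = 0 by apply: val_inj; rewrite /= rmorph0.
have v_alg : algebraicOver a v.
  have [p p_nz pv] := Fbar_algebraic v.
  have jp : map_poly a (map_poly j p) = map_poly iota p.
    by apply/polyP => k; rewrite coef_map coef_map_id0 // coef_map.
  exists (map_poly j p); last by rewrite jp.
  apply: contraNneq p_nz => jp0; move: jp; rewrite jp0 rmorph0 => /esym/eqP.
  by rewrite map_poly_eq0.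
have [p [p_nz pv p_min]] := annihilating_generator v_alg.
have [w pw] : exists w, root (map_poly b p) w.
  apply/closed_rootP; rewrite size_map_poly.
  apply: contraTneq pv => /eqP/size_poly1P[c c_nz ->].
  by rewrite map_polyC rootC fmorph_eq0.
have S'_hom : partial_hom iota (range (fun q : {poly E} =>
    ((map_poly a q).[v], (map_poly b q).[w]))).
  apply: adjoin_partial_hom => [c|q /p_min /dvdpP[k ->]]; first by exists (j c).
  by rewrite rmorphM rootM pw orbT.
exists w; apply: (S_max _ S'_hom) => [u Su|].
  have uE : u \in graph_pred S_hom by apply/asboolP.
  exists ((exist (fun u => u \in graph_pred S_hom) u uE : E)%:P) => //.
  by rewrite !map_polyC !hornerC /= -surjective_pairing.
by exists 'X => //; rewrite !map_polyX !hornerX.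
Qed.

(** For surjectivity, [w] is a root of some [p] over [F]. As [sigma] fixes [p], applying it to the
    split form of [p] shows that every root is the image of a root. *)
Lemma endomorphism_bijective (sigma : {rmorphism Fbar -> Fbar}) :
  (forall c, sigma (iota c) = iota c) -> bijective sigma.
Proof.
move=> sF; have surj w : exists z, sigma z = w.
  have [p p_nz pw] := Fbar_algebraic w.
  have [r pE] := closed_field_poly_normal (map_poly iota p).
  have : map_poly sigma (map_poly iota p) = map_poly iota p.
    by apply/polyP => k; rewrite !coef_map /= sF.
  rewrite {1}pE map_polyZ rmorph_prod /= => E; move: pw.
  rewrite -E rootZ ?fmorph_eq0 ?lead_coef_eq0 ?map_poly_eq0 //.
  under eq_bigr do rewrite rmorphB /= map_polyX map_polyC /=.
  rewrite -(big_map sigma predT (fun y => 'X - y%:P)) root_prod_XsubC.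
  by case/mapP => z _ ->; exists z.
exists (fun w => sval (cid (surj w))) => w; last by case: cid.
by apply: (fmorph_inj sigma); case: cid.
Qed.

(** The map F[z] -> F[w] with z -> w is a partial homomorphism; a maximal extension is total, hence
    an endomorphism over [F], hence bijective. *)
Lemma conjugate_automorphism (z w : Fbar) :
  (forall p : {poly F}, root (map_poly iota p) z -> root (map_poly iota p) w) ->
  exists tau : galois iota, tau z = w.
Proof.
move=> zw; have [|S [S_hom subS S_max]] :=
  @maximal_partial_hom _ _ iota _ (adjoin_partial_hom _ zw).
  by move=> c; exists c.
have S_total := maximal_partial_hom_total S_hom S_max.
have [SF SB SM S1] := S_hom.
pose sigma v := sval (cid (S_total v)).
have sP v : S (v, sigma v) by rewrite /sigma; case: cid.
have sU u v : S (u, v) -> sigma u = v.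
  move=> Suv; apply/eqP; rewrite -subr_eq0; apply/eqP/S1.
  by have := SB _ _ (sP u) Suv; congr (S _); congr (_, _); rewrite /= subrr.
have sB : zmod_morphism sigma by move=> u v; apply/sU/(SB _ _ (sP u) (sP v)).
have sM : monoid_morphism sigma.
  split=> [|u v]; last by apply/sU/(SM _ _ (sP u) (sP v)).
  by apply: sU; have := SF 1; rewrite rmorph1.
pose s : {rmorphism Fbar -> Fbar} := HB.pack sigma
  (GRing.isZmodMorphism.Build _ _ sigma sB) (GRing.isMonoidMorphism.Build _ _ sigma sM).
have sF c : s (iota c) = iota c by apply: sU.
exists (Galois (endomorphism_bijective sF) sF); apply/sU/subS.
by exists 'X => //; rewrite !map_polyX !hornerX.
Qed.

(** Each root of the minimal polynomial is conjugate to [z], so equals [z]. The polynomial is thus a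
    multiple of ('X - z)^n, and characteristic zero allows [z] to be read off from a coefficient. *)
Lemma fixed_field (z : Fbar) : [pchar F] =i pred0 ->
  (forall tau : galois iota, tau z = z) -> exists c, z = iota c.
Proof.
move=> char0 z_fixed.
have [p [p_nz pz p_min]] := annihilating_generator (Fbar_algebraic z).
have [r pE] := closed_field_poly_normal (map_poly iota p).
have lc_nz : lead_coef (map_poly iota p) != 0 by rewrite lead_coef_eq0 map_poly_eq0.
have r_z w : w \in r -> w = z.
  move=> wr; have [|tau <-] := @conjugate_automorphism z w; last exact: z_fixed.
  move=> q /p_min /dvdpP[k ->].
  have pw : root (map_poly iota p) w by rewrite pE rootZ // root_prod_XsubC.
  by rewrite rmorphM rootM pw orbT.
have rE : r = nseq (size r) z.
  by apply/all_pred1P/allP => w /r_z ->; rewrite /= eqxx.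
have zr : z \in r by move: pz; rewrite pE rootZ // root_prod_XsubC.
set n := size r in rE; have n_gt0 : (0 < n)%N by rewrite /n; case: (r) zr.
have n_nz : n%:R != 0 :> F by rewrite ((pcharf0P F).1 char0) -lt0n.
(* The coefficient of degree n - 1 of ('X - z)^n is -nz. *)
have := coefPn_prod_XsubC (_ : size r != 0); rewrite -/n -lt0n => /(_ n_gt0).
rewrite {2}rE big_nseq iter_addr_0 => prodE.
have := congr1 (fun q : {poly Fbar} => q`_n.-1) pE.
rewrite coef_map coefZ prodE lead_coef_map => /= cE.
exists (- p`_n.-1 / (lead_coef p * n%:R)).
rewrite rmorphM rmorphN cE fmorphV rmorphM rmorph_nat mulrN opprK.
rewrite -[z *+ n]mulr_natr mulrCA mulfK //.
by rewrite -(rmorph_nat iota) -rmorphM fmorph_eq0 mulf_neq0 // lead_coef_eq0.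
Qed.

End Automorphisms.

(** * Sums over finite Galois orbits *)

Section Average.

Variables (F : fieldType) (Fbar : closedFieldType) (iota : {rmorphism F -> Fbar}).
Hypothesis Fbar_algebraic : forall z : Fbar, algebraicOver iota z.

Definition galois_id : galois iota :=
  @Galois _ _ iota idfun (Bijective (frefl _) (frefl _)) (fun _ => erefl).

Fact galois_comp_fix (sigma tau : galois iota) c : (sigma \o tau) (iota c) = iota c.
Proof. by rewrite /= !galois_fix. Qed.

Definition galois_comp (sigma tau : galois iota) : galois iota :=
  @Galois _ _ iota (sigma \o tau)
    (bij_comp (galois_bij sigma) (galois_bij tau)) (galois_comp_fix sigma tau).

Lemma finite_conjugates (z : Fbar) :
  exists r : seq Fbar, forall tau : galois iota, tau z \in r.
Proof.
have [p p_nz pz] := Fbar_algebraic z.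
have [r pE] := closed_field_poly_normal (map_poly iota p); exists r => tau.
have E : map_poly tau (map_poly iota p) = map_poly iota p.
  by apply/polyP => k; rewrite !coef_map /= galois_fix.
have : root (map_poly iota p) (tau z).
  by rewrite -E rootE horner_map (eqP pz) rmorph0.
by rewrite pE rootZ ?root_prod_XsubC // lead_coef_eq0 map_poly_eq0.
Qed.

Lemma finite_orbit (zs : seq Fbar) :
  exists c : seq (seq Fbar), forall tau : galois iota, map tau zs \in c.
Proof.
elim: zs => [|z zs [c cP]]; first by exists [:: [::]] => tau; rewrite inE.
have [r rP] := finite_conjugates z.
exists [seq a :: t | a <- r, t <- c] => tau.
exact: (allpairs_f cons (rP tau) (cP tau)).
Qed.

(** The list [ts] holds one automorphism for each tuple in the orbit of [zs]. Working with the whole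
    tuple lets a single [ts] serve all entries at once, which the descent of a tensor with several
    terms requires. *)
Lemma galois_average (zs : seq Fbar) : [pchar F] =i pred0 ->
  exists ts : seq (galois iota), (0 < size ts)%N /\
    forall z, z \in zs -> exists c, \sum_(tau <- ts) tau z = iota c.
Proof.
move=> char0; have [cand candP] := finite_orbit zs.
pose O := [seq t <- undup cand | `[< exists tau : galois iota, t = map tau zs >]].
have OP t : reflect (exists tau : galois iota, t = map tau zs) (t \in O).
  rewrite mem_filter mem_undup; apply: (iffP andP) => [[/asboolP]//|E].
  by split; [apply/asboolP | case: E => tau ->].
have O_uniq : uniq O by rewrite filter_uniq ?undup_uniq.
(* Outside [O] the choice is arbitrary, and [galois_id] is the default. *)
have pick t : exists tau : galois iota, t \in O -> t = map tau zs.
  have [[tau ->]|] := OP t; first by exists tau.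
  by exists galois_id.
pose rep t := sval (cid (pick t)).
have repP t : t \in O -> t = map (rep t) zs by rewrite /rep; case: cid.
exists (map rep O); split.
  have : zs \in O by apply/OP; exists galois_id; rewrite /= map_id.
  by rewrite size_map; case: (O).
move=> z /(nthP 0)[i ltis <-].
have sumE : \sum_(tau <- map rep O) tau zs`_i = \sum_(t <- O) t`_i.
  rewrite big_map big_seq [RHS]big_seq; apply: eq_bigr => t /repP tE.
  by rewrite [in RHS]tE (nth_map 0).
suff [c cE] : exists c, \sum_(t <- O) t`_i = iota c by exists c; rewrite sumE.
apply: (fixed_field Fbar_algebraic char0) => tau.
(* Applying [tau] entrywise is injective and maps [O] into itself, so by counting it permutes [O];
   the coordinate sum is therefore fixed. *)
have perm : perm_eq (map (map tau) O) O.
  have mapO_uniq : uniq (map (map tau) O).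
    by rewrite map_inj_uniq //; apply/inj_map/fmorph_inj.
  apply: uniq_perm => //.
  apply: (uniq_min_size mapO_uniq _ _).2; last by rewrite size_map.
  move=> _ /mapP[_ /OP[sigma ->] ->]; apply/OP; exists (galois_comp tau sigma).
  by rewrite -map_comp.
rewrite -[RHS](perm_big _ perm) /= big_map rmorph_sum.
rewrite big_seq [RHS]big_seq; apply: eq_bigr => t /OP[sigma ->].
by rewrite [RHS](nth_map 0) ?size_map.
Qed.

End Average.

(** * Additive maps on tensor products *)

Section TensorMaps.

Variables (K A B : comPzRingType) (i : K -> A) (j : K -> B).
Local Notation T := (tensor i j).
Local Notation tens := (tens i j).

Definition tens_inr (b : B) : T := tens 1 b.

Fact tens_inl_is_zmod_morphism : zmod_morphism (tens_inl i j).
Proof. by have [t1 _ _] := tens_balanced i j; apply: t1. Qed.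

Fact tens_inl_is_monoid_morphism : monoid_morphism (tens_inl i j).
Proof. by split=> // a a'; rewrite /tens_inl tensM mulr1. Qed.

Fact tens_inr_is_zmod_morphism : zmod_morphism tens_inr.
Proof. by have [_ t2 _] := tens_balanced i j; apply: t2. Qed.

Fact tens_inr_is_monoid_morphism : monoid_morphism tens_inr.
Proof. by split=> // b b'; rewrite /tens_inr tensM mulr1. Qed.

HB.instance Definition _ :=
  GRing.isZmodMorphism.Build A T (tens_inl i j) tens_inl_is_zmod_morphism.
HB.instance Definition _ :=
  GRing.isMonoidMorphism.Build A T (tens_inl i j) tens_inl_is_monoid_morphism.
HB.instance Definition _ :=
  GRing.isZmodMorphism.Build B T tens_inr tens_inr_is_zmod_morphism.
HB.instance Definition _ :=
  GRing.isMonoidMorphism.Build B T tens_inr tens_inr_is_monoid_morphism.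

Lemma tens_inlr a b : tens_inl i j a * tens_inr b = tens a b.
Proof. by rewrite /tens_inl /tens_inr tensM mulr1 mul1r. Qed.

Lemma tens_scalar c : tens_inl i j (i c) = tens_inr (j c).
Proof.
by have [_ _ t3] := tens_balanced i j; have := t3 c 1 1; rewrite !mulr1.
Qed.

Lemma eq_copair (R : comPzRingType) (e e' : A -> R) (k k' : B -> R) :
  e =1 e' -> k =1 k' -> (copair e k : T -> R) =1 copair e' k'.
Proof. by move=> Ee Ek u; apply: eq_bigr => p _; rewrite Ee Ek. Qed.

Lemma copair_comp (R R' : comPzRingType) (m : {rmorphism R -> R'})
    (e : A -> R) (k : B -> R) (u : T) :
  m (copair e k u) = copair (m \o e) (m \o k) u.
Proof.
by rewrite /copair /tlift /eval_sum rmorph_sum; apply: eq_bigr => p _; rewrite rmorphM.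
Qed.

Lemma copair_inlr (u : T) : copair (tens_inl i j) tens_inr u = u.
Proof.
rewrite [RHS]tensor_sumE; apply: eq_bigr => p _; exact: tens_inlr.
Qed.

(** Point derivations are linear over the constants but not multiplicative, so [copair] and [act]
    are also needed for such an [e] in place of a ring morphism. *)
Definition linear_along (R : comPzRingType) (s : K -> R) (e : A -> R) : Prop :=
  zmod_morphism e /\ forall c a, e (i c * a) = s c * e a.

Lemma rmorph_linear_along (R : comPzRingType) (e : {rmorphism A -> R}) :
  linear_along (e \o i) e.
Proof. by split=> [|c a]; [apply: rmorphB | apply: rmorphM]. Qed.

Lemma linear_along_comp (R R' : comPzRingType) (s : K -> R) (e : A -> R)
    (m : {rmorphism R -> R'}) :
  linear_along s e -> linear_along (m \o s) (m \o e).
Proof. by move=> [eB eZ]; split=> [u v|c a] /=; rewrite ?eB ?eZ (rmorphB, rmorphM). Qed.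

Section Copair.

Variables (R : comPzRingType) (s : K -> R) (e : A -> R) (k : {rmorphism B -> R}).
Hypotheses (e_lin : linear_along s e) (ks : k \o j =1 s).

Lemma linear_copair_balanced : balanced i j (fun a b => e a * k b).
Proof.
have [eB eZ] := e_lin; split=> [b x y | a x y | c a b] /=.
- by rewrite eB mulrBl.
- by rewrite rmorphB mulrBr.
- by rewrite eZ rmorphM [k (j c)]ks mulrCA mulrA.
Qed.

Lemma linear_copairE a b : copair e k (tens a b) = e a * k b.
Proof. by rewrite /copair tliftE //; exact: linear_copair_balanced. Qed.

Lemma linear_copairB : zmod_morphism (copair e k : T -> R).
Proof. exact/tlift_is_zmod_morphism/linear_copair_balanced. Qed.

Lemma linear_copairD (u v : T) : copair e k (u + v) = copair e k u + copair e k v.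
Proof. exact/tliftD/linear_copair_balanced. Qed.

Lemma linear_copair0 : copair e k (0 : T) = 0.
Proof. exact/tlift0/linear_copair_balanced. Qed.


Lemma linear_copairZ c (u : T) :
  copair e k (tens_inl i j (i c) * u) = s c * copair e k u.
Proof.
have [_ eZ] := e_lin; elim/tensor_ind: u => [|a b u IH].
  by rewrite !mulr0 linear_copair0 mulr0.
by rewrite mulrDr !linear_copairD IH /tens_inl tensM mul1r !linear_copairE eZ mulrDr mulrA.
Qed.

End Copair.

Lemma tmap_copair (A' B' : comPzRingType) (i' : K -> A') (j' : K -> B')
    (f : A -> A') (g : B -> B') (u : T) :
  tmap f g u = copair (tens_inl i' j' \o f) (fun b => Defs.tens i' j' 1 (g b)) u.
Proof. by apply: eq_bigr => p _; rewrite /= /tens_inl tensM mulr1 mul1r. Qed.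

End TensorMaps.

Lemma copair_tmap (K A A' B R : comPzRingType) (i : K -> A) (i' : K -> A')
    (j : K -> B) (e : A -> A') (f : {rmorphism A' -> R}) (k : {rmorphism B -> R})
    (u : tensor i j) :
  linear_along i i' e -> f \o i' =1 k \o j ->
  copair f k (tmap e idfun u : tensor i' j) = copair (f \o e) k u.
Proof.
move=> e_lin fk; have fe_lin := linear_along_comp f e_lin; have [eB eZ] := e_lin.
have idB : zmod_morphism (idfun : B -> B) by [].
suff E : copair f k \o (tmap e idfun : tensor i j -> tensor i' j) =1
    copair (f \o e) k by exact: E.
apply: tensor_ext.
- by move=> v w; rewrite /= (tmap_is_zmod_morphism eB idB eZ) // (copair_is_zmod_morphism fk).
- exact: (linear_copairB fe_lin (fun c => esym (fk c))).
move=> a b; rewrite /= (tmap_tens eB idB eZ) // (copairE fk).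
by rewrite (linear_copairE fe_lin (fun c => esym (fk c))).
Qed.

(** Both sides are biadditive in [u] and [v], which reduces the claim to pure tensors; there it is
    the rule for [e] multiplied by k(b b'). *)
Lemma copair_derivation (K A B R : comPzRingType) (i : K -> A) (j : K -> B)
    (s : K -> R) (x e : A -> R) (k : {rmorphism B -> R}) (u v : tensor i j) :
  linear_along i s x -> linear_along i s e -> k \o j =1 s ->
  (forall a b, e (a * b) = x a * e b + x b * e a) ->
  copair e k (u * v) = copair x k u * copair e k v + copair x k v * copair e k u.
Proof.
move=> x_lin e_lin ks eM.
pose xk := copair x k : tensor i j -> R; pose ek := copair e k : tensor i j -> R.
have x0 := linear_copair0 x_lin ks; have e0 := linear_copair0 e_lin ks.
have xD := linear_copairD x_lin ks; have eD := linear_copairD e_lin ks.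
have xE := linear_copairE x_lin ks; have eE := linear_copairE e_lin ks.
elim/tensor_ind: u => [|a b u IH]; first by rewrite mul0r e0 x0; ring.
rewrite mulrDl !(xD, eD) {}IH !mulrDl !mulrDr addrACA; congr (_ + _).
elim/tensor_ind: v => [|a' b' v IH]; first by rewrite mulr0 e0 x0; ring.
by rewrite mulrDr !(xD, eD) {}IH tensM !(xE, eE) eM rmorphM; ring.
Qed.

(** * Points of groups and torsors *)

Section CopairHom.

Variables (K A B R : comPzRingType) (i : K -> A) (j : K -> B).
Variables (f : {rmorphism A -> R}) (g : {rmorphism B -> R}).
Hypothesis fg : f \o i =1 g \o j.

Definition copair_hom : {rmorphism tensor i j -> R} :=
  HB.pack (copair f g : tensor i j -> R)
    (GRing.isZmodMorphism.Build _ _ (copair f g) (copair_is_zmod_morphism fg))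
    (GRing.isMonoidMorphism.Build _ _ (copair f g) (copair_is_monoid_morphism fg)).

Lemma copair_hom_inl : copair_hom \o tens_inl i j =1 f.
Proof. by move=> a; rewrite /= /tens_inl copairE // rmorph1 mulr1. Qed.

Lemma copair_hom_inr : copair_hom \o tens_inr i j =1 g.
Proof. by move=> b; rewrite /= /tens_inr copairE // rmorph1 mul1r. Qed.

End CopairHom.

Section GroupPoints.

Variables (K : fieldType) (G : linear_algebraic_group K).
Local Notation H := (gring G).

Lemma algHom_scalar (k : comPzRingType) (A : comAlgType k) (R : comPzRingType)
    (s : k -> R) (x : algHom A s) : x \o in_alg A =1 s.
Proof. by move=> c; rewrite /= algHomE. Qed.

Definition algHom_comp (k : comPzRingType) (A : comAlgType k) (R R' : comPzRingType)
    (s : k -> R) (m : {rmorphism R -> R'}) (x : algHom A s) : algHom A (m \o s).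
Proof.
by exists (m \o x); abstract by move=> c; rewrite /= algHomE.
Defined.

Section Conv.

Variables (R : comPzRingType) (s : K -> R) (g h : algHom H s).

Fact conv_compatible : g \o in_alg H =1 h \o in_alg H.
Proof. by move=> c; rewrite !algHom_scalar. Qed.

Fact conv_scalar c : (copair_hom conv_compatible \o comul G) c%:A = s c.
Proof. by rewrite /= algHomE; exact: etrans (copair_hom_inl conv_compatible _) (algHomE g c). Qed.

Definition conv_hom : algHom H s :=
  @AlgHom _ _ _ s (copair_hom conv_compatible \o comul G) conv_scalar.

End Conv.

End GroupPoints.

Section TorsorPoints.

Variables (K F : fieldType) (kappa : {rmorphism K -> F}).
Variables (G : linear_algebraic_group K) (X : torsor kappa G).
Local Notation A := (xring X).
Local Notation H := (gring G).
Local Notation iK := (in_alg A \o kappa).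
Local Notation jK := (in_alg H).
Local Notation rho := (coact X).

Lemma point_linear_along (R : comPzRingType) (s : F -> R) (x : algHom A s) :
  linear_along iK (s \o kappa) x.
Proof.
have [xB xZ] := rmorph_linear_along iK x; split=> // c a.
by rewrite xZ /= algHomE.
Qed.

Lemma act_comp (R R' : comPzRingType) (m : {rmorphism R -> R'})
    (e : A -> R) (k : H -> R) (f : A) :
  m (act rho e k f) = act rho (m \o e) (m \o k) f.
Proof. exact: copair_comp. Qed.

Lemma eq_act (R : comPzRingType) (e e' : A -> R) (k k' : H -> R) :
  e =1 e' -> k =1 k' -> act rho e k =1 act rho e' k'.
Proof. by move=> Ee Ek f; apply: eq_copair. Qed.

Lemma coact_scalar c a :
  rho (iK c * a) = tens_inl iK jK (iK c) * rho a.
Proof. by rewrite rmorphM algHomE. Qed.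

Lemma act_linear_along (R : comPzRingType) (s : K -> R) (e : A -> R)
    (g : algHom H s) :
  linear_along iK s e -> linear_along iK s (act rho e g).
Proof.
move=> e_lin; have gs := algHom_scalar g; split=> [u v|c a]; rewrite /act /comp.
  by rewrite rmorphB (linear_copairB e_lin gs).
by rewrite coact_scalar (linear_copairZ e_lin gs).
Qed.

Section ActHom.

Variables (R : comPzRingType) (s : F -> R) (x : algHom A s).
Variable g : algHom H (s \o kappa).

Fact act_compatible : x \o iK =1 g \o jK.
Proof. by move=> c; rewrite /= !algHomE. Qed.

Fact act_scalar c : (copair_hom act_compatible \o rho) c%:A = s c.
Proof. by rewrite /= algHomE; exact: etrans (copair_hom_inl act_compatible _) (algHomE x c). Qed.

Definition act_hom : algHom A s :=
  @AlgHom _ _ _ s (copair_hom act_compatible \o rho) act_scalar.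

End ActHom.

(** [act_unit] at the identity point of [A] gives the counit law for [rho] itself, to which the
    linear map [e] can be applied. *)
Lemma act_unit_linear (R : comPzRingType) (s : {rmorphism K -> R}) (e : A -> R) :
  linear_along iK s e -> act rho e (s \o counit G) =1 e.
Proof.
move=> e_lin f.
have idE c : idfun (c%:A : A) = in_alg A c by [].
have := act_unit (@AlgHom _ _ _ (in_alg A) idfun idE) f.
rewrite /act /comp /= => idP; rewrite -[in RHS]idP.
pose eps : {rmorphism H -> R} := s \o counit G.
have eps_lin : eps \o jK =1 s by move=> c; rewrite /= algHomE.
pose eta : {rmorphism H -> A} := iK \o counit G.
have eta_lin : idfun \o iK =1 eta \o jK by move=> c; rewrite /= algHomE.
have [eB eZ] := e_lin.
apply: (tensor_ext (i := iK) (j := jK) (h := copair e eps)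
  (h' := e \o (copair idfun eta : tensor iK jK -> A))).
- exact: linear_copairB.
- by move=> u v; rewrite /= (copair_is_zmod_morphism eta_lin) eB.
- move=> a b; rewrite /= (linear_copairE e_lin eps_lin) (copairE eta_lin).
  by rewrite [_ * eta b]mulrC eZ mulrC.
Qed.

(* [act_conv] at the universal points over (A (x) H) (x) H gives coassociativity of
   rho, which is then pushed forward along e (x) g (x) h. *)
Lemma act_conv_linear (R : comPzRingType) (s : K -> R) (e : A -> R)
    (g h : algHom H s) : linear_along iK s e ->
  act rho (act rho e g) h =1 act rho e (conv (comul G) g h).
Proof.
move=> e_lin f.
pose inl2 : {rmorphism A -> tensor (tens_inl iK jK \o iK) jK} :=
  tens_inl (tens_inl iK jK \o iK) jK \o tens_inl iK jK.
pose s3 := inl2 \o in_alg A.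
have i1_scalar c : inl2 c%:A = s3 c by [].
pose i1 : algHom A s3 := AlgHom i1_scalar.
pose inlr : {rmorphism H -> tensor (tens_inl iK jK \o iK) jK} :=
  tens_inl (tens_inl iK jK \o iK) jK \o tens_inr iK jK.
have i2_scalar c : inlr c%:A = (s3 \o kappa) c.
  by rewrite /inlr /= -[_%:A]/(jK c) -tens_scalar.
pose i2 : algHom H (s3 \o kappa) := AlgHom i2_scalar.
pose inr3 : {rmorphism H -> tensor (tens_inl iK jK \o iK) jK} :=
  tens_inr (tens_inl iK jK \o iK) jK.
have i3_scalar c : inr3 c%:A = (s3 \o kappa) c.
  by rewrite /inr3 /= -[_%:A]/(jK c) -tens_scalar.
pose i3 : algHom H (s3 \o kappa) := AlgHom i3_scalar.
have gs := algHom_scalar g; have hs := algHom_scalar h.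
have L_lin : linear_along (tens_inl iK jK \o iK) s (copair e g).
  by split=> [|c u]; [exact: (linear_copairB e_lin gs) | exact: (linear_copairZ e_lin gs)].
(* [L] is e (x) g (x) h followed by multiplication. It is only additive, so both sides of
   coassociativity are compared with it on pure tensors. *)
pose L := copair (copair e g) h : tensor (tens_inl iK jK \o iK) jK -> R.
have LB : zmod_morphism L by apply: (linear_copairB L_lin hs).
have LE u b : L (tens_inl _ _ u * tens_inr _ _ b) = copair e g u * h b.
  by rewrite tens_inlr; apply: (linear_copairE L_lin hs).
have left (u : tensor iK jK) : L (copair (act rho i1 i2) i3 u) = copair (act rho e g) h u.
  have act_lin := act_linear_along i2 (point_linear_along i1).
  suff E : L \o (copair (act rho i1 i2) i3 : tensor iK jK -> _) =1
           copair (act rho e g) h by exact: E.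
  apply: tensor_ext.
  - by move=> v w; rewrite /= (linear_copairB act_lin (algHom_scalar i3)) LB.
  - exact: linear_copairB (act_linear_along g e_lin) hs.
  move=> a b; rewrite /= (linear_copairE act_lin (algHom_scalar i3)).
  rewrite (linear_copairE (act_linear_along g e_lin) hs).
  have -> : act rho i1 i2 a = tens_inl (tens_inl iK jK \o iK) jK (rho a).
    by rewrite /act /= -[in RHS](copair_inlr (rho a)) copair_comp.
  exact: LE.
have right (u : tensor iK jK) :
    L (copair i1 (conv (comul G) i2 i3) u) = copair e (conv (comul G) g h) u.
  have i1_lin := point_linear_along i1.
  have conv_s := algHom_scalar (conv_hom g h).
  have conv_s3 := algHom_scalar (conv_hom i2 i3).
  suff E : L \o (copair i1 (conv_hom i2 i3) : tensor iK jK -> _) =1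
           copair e (conv_hom g h) by exact: E.
  apply: tensor_ext.
  - by move=> v w; rewrite /= (linear_copairB i1_lin conv_s3) LB.
  - exact: linear_copairB e_lin conv_s.
  move=> a b; rewrite /= (linear_copairE i1_lin conv_s3).
  rewrite (linear_copairE e_lin conv_s) /=.
  have gh := conv_compatible g h; have i23 := conv_compatible i2 i3.
  apply: (tensor_ext (i := jK) (j := jK) (h := fun v => L (inl2 a * copair i2 i3 v))
    (h' := fun v => e a * copair g h v)).
  - by move=> v w; rewrite (copair_is_zmod_morphism i23) mulrBr LB.
  - by move=> v w; rewrite (copair_is_zmod_morphism gh) mulrBr.
  move=> b1 b2; rewrite (copairE i23) (copairE gh).
  have -> : inl2 a * (i2 b1 * i3 b2) =
      tens_inl (tens_inl iK jK \o iK) jK (tens iK jK a b1) * tens_inr _ _ b2.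
    by rewrite -[tens _ _ a b1]tens_inlr rmorphM -mulrA.
  by rewrite LE (linear_copairE e_lin gs) mulrA.
rewrite {1}/act /= -left -[RHS]right; congr L.
exact: (act_conv i1 i2 i3 f).
Qed.

End TorsorPoints.

(** * Galois descent *)

Section Descent.

Variables (F : fieldType) (Fbar : closedFieldType) (iota : {rmorphism F -> Fbar}).
Variable A : comAlgType F.
Local Notation R := (tensor (in_alg A) iota).

(** The retraction is a (x) z -> t(z) a, for an [F]-linear retraction [t] of [iota]. *)
Lemma extension_retraction : exists r : R -> A,
  [/\ zmod_morphism r, forall a, r (tens_inl _ _ a) = a
    & forall c u, r (tens_inl _ _ c%:A * u) = c%:A * r u].
Proof.
have [t [tB tZ t1]] := linear_retraction iota.
have bal : balanced (in_alg A) iota (fun a z => (t z)%:A * a).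
  split=> [z a b|a z w|c a z] /=.
  - by rewrite mulrBr.
  - by rewrite tB scalerBl mulrBl.
  - by rewrite tZ mulrCA mulrA -[(c * t z)%:A]/(in_alg A (c * t z)) rmorphM.
exists (tlift (fun a z => (t z)%:A * a)); split.
- exact: tlift_is_zmod_morphism.
- by move=> a; rewrite /tens_inl tliftE // t1 scale1r mul1r.
- move=> c u; elim/tensor_ind: u => [|a z u IH].
    by rewrite mulr0 !tlift0 // mulr0.
  by rewrite mulrDr !tliftD // IH mulrDr /tens_inl tensM mul1r !tliftE // mulrCA.
Qed.

(** Since [w] is fixed, n w is the sum of its images under [n] automorphisms, chosen so that the
    sums of the conjugates of every [Fbar]-entry of a presentation of [w] lie in [F]. Each term then
    moves into [A], and [n] is invertible. *)
Lemma galois_descent (w : R) : [pchar F] =i pred0 ->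
  (forall z : Fbar, algebraicOver iota z) ->
  (forall tau : galois iota, tmap idfun tau w = w) ->
  exists a, w = tens_inl _ _ a.
Proof.
move=> char0 Fbar_algebraic w_fixed.
have [ts [ts_gt0 ts_sum]] :=
  galois_average Fbar_algebraic (map snd (repr w)) char0.
have [t1 t2 t3] := tens_balanced (in_alg A) iota.
have tau_bal (tau : galois iota) :
    balanced (in_alg A) iota (fun a z => Defs.tens (in_alg A) iota a (tau z)).
  by split=> [z a b|a z y|c a z] /=; rewrite ?rmorphB ?rmorphM ?galois_fix ?(t1,t2,t3).
have n_nz : (size ts)%:R != 0 :> F by rewrite ((pcharf0P F).1 char0) -lt0n.
have [s sE] : exists s, w *+ size ts = tens_inl _ _ s.
  have -> : w *+ size ts = \sum_(tau <- ts) tmap idfun tau w.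
    under eq_bigr do rewrite w_fixed.
    by rewrite big_const_seq count_predT iter_addr_0.
  have tauE (tau : galois iota) :
      tmap idfun tau w = \sum_(p <- repr w) Defs.tens (in_alg A) iota p.1 (tau p.2).
    by rewrite [in LHS](tensor_sumE w) /tmap tlift_sum; [apply: eq_bigr => p _; rewrite tliftE|].
  under eq_bigr do rewrite tauE.
  rewrite exchange_big /= big_seq.
  elim/big_ind: _ => [|_ _ [a ->] [b ->]|p pw].
  - by exists 0; rewrite rmorph0.
  - by exists (a + b); rewrite rmorphD.
  have [c cE] := ts_sum p.2 (map_f snd pw).
  exists (c%:A * p.1).
  have -> : \sum_(tau <- ts) Defs.tens (in_alg A) iota p.1 (galois_fun tau p.2)
      = Defs.tens (in_alg A) iota p.1 (\sum_(tau <- ts) galois_fun tau p.2).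
    rewrite -[RHS]tens_inlr rmorph_sum mulr_sumr.
    by apply: eq_bigr => tau _; rewrite tens_inlr.
  have cs : tens_inl (in_alg A) iota c%:A = tens_inr (in_alg A) iota (iota c).
    exact: tens_scalar.
  by rewrite cE rmorphM /= cs mulrC tens_inlr.
pose inl : {rmorphism A -> R} := tens_inl (in_alg A) iota.
have n1 : inl (in_alg A (size ts)%:R^-1) * (size ts)%:R = 1.
  by rewrite -(rmorph_nat (inl \o in_alg A)) -!rmorphM mulVf // !rmorph1.
exists (in_alg A (size ts)%:R^-1 * s).
by rewrite rmorphM /= -sE -[w *+ _]mulr_natr mulrCA n1 mulr1.
Qed.

End Descent.

(** * The twisting isomorphism *)

Section PointDerivations.

Variables (K F : fieldType) (kappa : {rmorphism K -> F}).
Variables (G : linear_algebraic_group K) (X : torsor kappa G).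
Variables (Fbar : closedFieldType) (iota : {rmorphism F -> Fbar}).
Variable x : algHom (xring X) iota.
Local Notation A := (xring X).
Local Notation H := (gring G).
Local Notation iK := (in_alg A \o kappa).
Local Notation jK := (in_alg H).
Local Notation sK := (iota \o kappa).
Local Notation rho := (coact X).
Local Notation B := (tensor sK jK).
Local Notation inlB := (tens_inl sK jK).
Local Notation inrB := (tens_inr sK jK).

Lemma tdivP (R : comPzRingType) (s : {rmorphism F -> R}) (y z : algHom A s) :
  z =1 act rho y (tdiv y z).
Proof. by rewrite /tdiv; case: cid => g []. Qed.

Lemma transport_act (y z : algHom A iota) (e : A -> Fbar) :
  linear_along iK sK e -> transport y z e =1 act rho e (tdiv y z).
Proof.
move=> e_lin f; apply: (copair_tmap _ e_lin) => c.
by rewrite /= algHomE.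
Qed.

Fact inrB_scalar c : inrB c%:A = (inlB \o sK) c.
Proof. exact/esym/tens_scalar. Qed.

Definition generic_point : algHom H (inlB \o sK) := AlgHom inrB_scalar.

(* For a point e = x of X this is x.g with g the universal point of G, and for a
   point derivation e it is the map (e (x) id) o rho. *)
Definition spread (e : A -> Fbar) : A -> B := act rho (inlB \o e) inrB.

(** Its underlying map is convertible to [spread x], which thereby inherits the ring morphism
    laws. *)
Definition spread_point : algHom A (inlB \o iota) :=
  act_hom (algHom_comp inlB x) generic_point.

Lemma spread_linear_along (e : A -> Fbar) :
  linear_along iK sK e -> linear_along iK (inlB \o sK) (spread e).
Proof.
move=> e_lin.
exact: (act_linear_along generic_point (linear_along_comp inlB e_lin)).
Qed.

(** Specializing the universal point in [spread e] to the product of [g] and [h] gives the action of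
    that product on [m \o e], which associativity splits in two. *)
Lemma conv_spread (R : comPzRingType) (s : K -> R) (m : {rmorphism Fbar -> R})
    (g h : algHom H s) (e : A -> Fbar) (f : A) :
  m \o sK =1 s -> linear_along iK sK e ->
  copair m (conv (comul G) g h) (spread e f) = act rho (act rho (m \o e) g) h f.
Proof.
move=> ms e_lin.
have mk : m \o sK =1 conv_hom g h \o jK.
  by move=> c; rewrite algHom_scalar ms.
have me_lin : linear_along iK s (m \o e).
  have [mB mZ] := linear_along_comp m e_lin.
  by split=> // c a; rewrite mZ ms.
rewrite (act_conv_linear g h me_lin) -[LHS]/(copair_hom mk _) act_comp.
apply: eq_act => a /=; first exact: (copair_hom_inl mk).
exact: (copair_hom_inr mk).
Qed.

(** Specializing the universal point to the identity of [G] recovers [e]. *)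
Lemma spread_evaluation (e : A -> Fbar) (f : A) : linear_along iK sK e ->
  copair idfun (sK \o counit G) (spread e f) = e f.
Proof.
move=> e_lin; pose eps : {rmorphism H -> Fbar} := sK \o counit G.
have E : idfun \o sK =1 eps \o jK by move=> c; rewrite /= algHomE.
rewrite -[RHS](act_unit_linear e_lin) -[LHS]/(copair_hom E _) act_comp.
by apply: eq_act => a /=; [apply: (copair_hom_inl E) | apply: (copair_hom_inr E)].
Qed.

Section Trivialization.

Local Notation R := (tensor (in_alg A) iota).
Local Notation inlR := (tens_inl (in_alg A) iota).
Local Notation inrR := (tens_inr (in_alg A) iota).

Definition base_scalar : {rmorphism F -> R} := inlR \o in_alg A.

Fact universal_scalar c : inlR c%:A = base_scalar c.
Proof. by []. Qed.
Definition universal_point : algHom A base_scalar := AlgHom universal_scalar.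

Fact constant_scalar c : (inrR \o x) c%:A = base_scalar c.
Proof. by rewrite /= algHomE; apply/esym/tens_scalar. Qed.
Definition constant_point : algHom A base_scalar := AlgHom constant_scalar.

Local Notation g := (tdiv constant_point universal_point).

Fact untwist_compatible : inrR \o sK =1 g \o jK.
Proof. by move=> c; rewrite /= algHomE; apply/esym/tens_scalar. Qed.
(** Over A (x) Fbar, [g] carries the base change of [x] to the universal point of [X]; it prescribes
    the map on K[G]. *)
Definition untwist : {rmorphism B -> R} := copair_hom untwist_compatible.

Fact twist_compatible : spread_point \o in_alg A =1 inlB \o iota.
Proof. exact: algHom_scalar. Qed.
Definition twist : {rmorphism R -> B} := copair_hom twist_compatible.

Lemma untwist_inl z : untwist (inlB z) = inrR z.
Proof. exact: (copair_hom_inl untwist_compatible). Qed.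

Lemma untwist_inr h : untwist (inrB h) = g h.
Proof. exact: (copair_hom_inr untwist_compatible). Qed.

Lemma twist_inl f : twist (inlR f) = spread x f.
Proof. exact: (copair_hom_inl twist_compatible). Qed.

Lemma twist_inr z : twist (inrR z) = inlB z.
Proof. exact: (copair_hom_inr twist_compatible). Qed.

Lemma untwist_spread f : untwist (spread x f) = inlR f.
Proof.
rewrite act_comp -[RHS]/(universal_point f) (tdivP constant_point).
by apply: eq_act => a /=; [apply: untwist_inl | apply: untwist_inr].
Qed.

Lemma twistK : cancel twist untwist.
Proof.
move=> u; suff E : untwist \o twist =1 idfun by exact: E.
apply: tensor_ext => [v w|//|a z]; first by rewrite rmorphB.
by rewrite -tens_inlr [LHS]/comp rmorphM twist_inl twist_inr rmorphM untwist_spread untwist_inl.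
Qed.

(** Over [B], both [twist \o g] and the universal point of [G] carry [x] to [spread_point]; simple
    transitivity makes them equal. *)
Lemma untwistK : cancel untwist twist.
Proof.
have twist_base : twist \o base_scalar =1 inlB \o iota.
  by move=> c; exact: etrans (twist_inl _) (algHomE spread_point c).
have gk c : (twist \o g) c%:A = ((inlB \o iota : {rmorphism F -> B}) \o kappa) c.
  by rewrite /= algHomE; apply: twist_base.
pose g1 : algHom H ((inlB \o iota : {rmorphism F -> B}) \o kappa) := AlgHom gk.
pose xB : algHom A (inlB \o iota : {rmorphism F -> B}) := algHom_comp inlB x.
have [g0 [_ g0P]] := act_simply_transitive xB spread_point.
have gE : twist \o g =1 inrB.
  have g1E : g1 =1 g0.
    apply: g0P => f; rewrite -[LHS]/(spread x f) -twist_inl.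
    rewrite -[inlR f]/(universal_point f) (tdivP constant_point) act_comp.
    by apply: eq_act => a //=; apply: twist_inr.
  move=> h; rewrite -[LHS]/(g1 h) g1E.
  exact/esym/(g0P generic_point).
move=> u; suff E : twist \o untwist =1 idfun by exact: E.
apply: tensor_ext => [v w|//|z h]; first by rewrite rmorphB.
by rewrite -tens_inlr [LHS]/comp rmorphM untwist_inl untwist_inr rmorphM twist_inr [twist _]gE.
Qed.

End Trivialization.

(** Linearity of the retraction over the constants keeps [spread x] injective after tensoring with
    K[G]. *)
Lemma spread_retraction : exists r : B -> A,
  linear_along (inlB \o sK) iK r /\ cancel (spread x) r.
Proof.
have [r [rB r_inl rZ]] := extension_retraction iota A.
exists (r \o untwist); split; last by move=> f; rewrite /comp untwist_spread.
split=> [u v|c u]; first by rewrite /comp rmorphB rB.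
rewrite /comp rmorphM untwist_inl -rZ; congr (r (_ * _)).
exact/esym/tens_scalar.
Qed.

(** It suffices to compare after the injective map spread x (x) id. By coassociativity the two sides
    become id (x) Delta applied to spread x (D f) and to spread e f. *)
Lemma spread_coact (D : A -> A) (e : A -> Fbar) (f : A) :
  linear_along iK iK D -> linear_along iK sK e -> spread x \o D =1 spread e ->
  rho (D f) = tmap D idfun (rho f).
Proof.
move=> D_lin e_lin De.
pose C : comPzRingType := tensor (inlB \o sK) jK.
pose inlC : {rmorphism B -> C} := tens_inl (inlB \o sK) jK.
pose inrC : {rmorphism H -> C} := tens_inr (inlB \o sK) jK.
have inrC_scalar c : inrC c%:A = (inlC \o (inlB \o sK)) c.
  exact/esym/tens_scalar.
pose h : algHom H (inlC \o (inlB \o sK)) := AlgHom inrC_scalar.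
(* [M] is id (x) Delta, expressed by the product of two independent universal points. *)
pose M : B -> C := copair (inlC \o inlB) (conv (comul G) (algHom_comp inlC generic_point) h).
have ME (e' : A -> Fbar) a : linear_along iK sK e' ->
    M (spread e' a) = act rho (inlC \o spread e') inrC a.
  move=> e'_lin; rewrite /M (@conv_spread _ _ _ _ h) //.
  by apply: eq_act => // b; rewrite [RHS]act_comp.
have x_lin := point_linear_along x.
have [r [[rB rZ] rK]] := spread_retraction.
have [sB sZ] := spread_linear_along x_lin.
have idB : zmod_morphism (idfun : H -> H) by [].
have tmapK (u : coact_ring kappa G A) :
    tmap r idfun (tmap (spread x) idfun u : C) = u.
  suff E : (tmap r idfun : C -> coact_ring kappa G A) \o tmap (spread x) idfun =1 idfun.
    exact: E.
  apply: tensor_ext => [v w|//|a b].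
    by rewrite /= (tmap_is_zmod_morphism sB idB sZ) // (tmap_is_zmod_morphism rB idB rZ).
  by rewrite /= (tmap_tens sB idB sZ) // (tmap_tens rB idB rZ) // rK.
rewrite -[LHS]tmapK -[RHS]tmapK; congr tmap.
have tmapE (u : coact_ring kappa G A) :
    tmap (spread x) idfun u = copair (inlC \o spread x) inrC u.
  by rewrite tmap_copair.
rewrite !tmapE -[LHS]/(act rho _ _ _) -ME //.
rewrite [spread x (D f)]De ME //.
have compat : inlC \o spread_point \o iK =1 inrC \o jK.
  by move=> c; rewrite /comp algHomE; apply: tens_scalar.
rewrite (copair_tmap (f := inlC \o spread_point) _ D_lin compat).
by apply: eq_copair => // a; exact: (congr1 inlC (esym (De a))).
Qed.

Section Equivariance.

Variables (dt : A -> Fbar) (tau : galois iota).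
Hypothesis dt_lin : linear_along iK sK dt.
Hypothesis dt_equiv : transport (galois_point tau x) x (tau \o dt) =1 dt.

Lemma galois_linear_along (e : A -> Fbar) :
  linear_along iK sK e -> linear_along iK sK (tau \o e).
Proof.
move=> e_lin; have [eB eZ] := linear_along_comp tau e_lin.
by split=> // c a; rewrite eZ /= galois_fix.
Qed.

Lemma untwist_galois_fixed f :
  tmap idfun tau (untwist (spread dt f)) = untwist (spread dt f).
Proof.
pose g := tdiv (galois_point tau x) x.
pose gB : algHom H (inlB \o sK) := algHom_comp inlB g.
pose m : {rmorphism Fbar -> B} := inlB \o tau.
have mK : m \o sK =1 inlB \o sK by move=> c; rewrite /= galois_fix.
have mC : m \o sK =1 conv_hom gB generic_point \o jK.
  by move=> c; rewrite [RHS]algHom_scalar mK.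
pose twisted : {rmorphism B -> B} := copair_hom mC.
(* [twisted] turns [spread e] into tau(e).g acted on by the universal point. Only linearity of [e]
   enters, so both [x] and [dt] are covered. *)
have fixes (e : A -> Fbar) a : linear_along iK sK e ->
    act rho (tau \o e) g =1 e -> twisted (spread e a) = spread e a.
  move=> e_lin eg; rewrite [LHS](@conv_spread _ _ _ _ generic_point) //.
  apply: eq_act => // b /=; rewrite -[e in RHS]/(e) -[in RHS]eg.
  by rewrite [RHS]act_comp.
(* On generators: [twisted] fixes every [spread x a] and acts as [tau] on [Fbar]. *)
have semilinear (u : tensor (in_alg A) iota) :
    twist (tmap idfun tau u) = twisted (twist u).
  have idB : zmod_morphism (idfun : A -> A) by [].
  have tauZ c z : tau (iota c * z) = iota c * tau z by rewrite rmorphM galois_fix.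
  suff E : twist \o (tmap idfun tau : _ -> tensor (in_alg A) iota) =1 twisted \o twist.
    exact: E.
  apply: tensor_ext => [v w|v w|a z].
  - by rewrite /comp (tmap_is_zmod_morphism idB (rmorphB tau)) // rmorphB.
  - by rewrite /comp !rmorphB.
  rewrite /comp (tmap_tens idB (rmorphB tau)) // -!tens_inlr !rmorphM.
  rewrite !twist_inl !twist_inr fixes; last by move=> b; apply/esym/(tdivP (galois_point tau x)).
    by congr (_ * _); apply/esym/(copair_hom_inl mC).
  exact: point_linear_along.
apply: (can_inj twistK); rewrite semilinear untwistK fixes // => a.
by rewrite -transport_act //; exact: galois_linear_along.
Qed.

End Equivariance.

(** The Leibniz term in which the constant is differentiated vanishes. *)
Lemma point_derivation_linear_along (d : F -> F) (dt : A -> Fbar) :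
  (forall c, d (kappa c) = 0) -> point_derivation d x dt -> linear_along iK sK dt.
Proof.
move=> d_const [dtB dtF dtM]; split=> // c a.
by rewrite dtM /= dtF d_const rmorph0 mulr0 addr0 algHomE.
Qed.

Lemma spread_equivariant (d : F -> F) (dt : A -> Fbar) :
  [pchar F] =i pred0 -> (forall z : Fbar, algebraicOver iota z) ->
  (forall c, d (kappa c) = 0) ->
  point_derivation d x dt -> galois_equivariant x dt ->
  forall f, exists a, spread x a = spread dt f.
Proof.
move=> char0 Fbar_algebraic d_const dt_der dt_equiv f.
have dt_lin := point_derivation_linear_along d_const dt_der.
have [|a aE] := galois_descent (w := untwist (spread dt f)) char0 Fbar_algebraic.
  by move=> tau; apply: untwist_galois_fixed.
by exists a; rewrite -twist_inl -aE untwistK.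
Qed.

End PointDerivations.

(** * Differential torsors *)

Section DifferentialTorsor.

Variables (K F : fieldType) (kappa : {rmorphism K -> F}) (d : F -> F).
Variables (G : linear_algebraic_group K) (X : torsor kappa G).
Hypothesis d_const : forall c, d (kappa c) = 0.
Local Notation A := (xring X).
Local Notation H := (gring G).
Local Notation iK := (in_alg A \o kappa).

Lemma differential_linear_along (D : A -> A) :
  differential_torsor d D -> linear_along iK iK D.
Proof.
move=> [[DB DM] DF _]; split=> // c a.
by rewrite DM /= DF d_const scale0r mul0r add0r.
Qed.

Lemma act_differential (R : comPzRingType) (s : F -> R) (z : algHom A s)
    (k : algHom H (s \o kappa)) (D : A -> A) :
  differential_torsor d D ->
  act (coact X) (z \o D) k =1 act (coact X) z k \o D.
Proof.
move=> D_diff f; have [_ _ Drho] := D_diff.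
rewrite /act /comp Drho (copair_tmap _ (differential_linear_along D_diff)) //.
by move=> c; rewrite /= !algHomE.
Qed.

Variables (Fbar : closedFieldType) (iota : {rmorphism F -> Fbar}).

Lemma differential_point_derivation (y : algHom A iota) (D : A -> A) :
  differential_torsor d D -> point_derivation d y (y \o D).
Proof.
move=> [[DB DM] DF _]; split=> [a b|a|a b] /=.
- by rewrite DB rmorphB.
- by rewrite DF algHomE.
- by rewrite DM rmorphD !rmorphM; ring.
Qed.

(** Taking for [y] the conjugate of [x] by [tau] and for [z] the point [x] yields
    Galois-equivariance of [x \o D]. *)
Lemma transport_differential (y z : algHom A iota) (D : A -> A) :
  differential_torsor d D -> transport y z (y \o D) =1 z \o D.
Proof.
move=> D_diff f; rewrite transport_act; last first.
  exact: point_derivation_linear_along d_const (differential_point_derivation y D_diff).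
by rewrite act_differential // [RHS](tdivP y z).
Qed.

End DifferentialTorsor.

Theorem proposition1p5
    (F : fieldType) (charF0 : [pchar F] =i pred0)
    (d : F -> F) (d_der : is_derivation d)
    (K : fieldType) (kappa : {rmorphism K -> F})
    (K_constants : range kappa = [set a : F | d a = 0])
    (G : linear_algebraic_group K) (X : torsor kappa G)
    (Fbar : closedFieldType) (iota : {rmorphism F -> Fbar})
    (Fbar_algebraic : forall z : Fbar, algebraicOver iota z)
    (x : algHom (xring X) iota) :
  set_bij
    [set D : xring X -> xring X | differential_torsor d D]
    [set dt : xring X -> Fbar |
      point_derivation d x dt /\ galois_equivariant x dt]
    (fun D => x \o D)
  /\
  (forall D : xring X -> xring X, differential_torsor d D ->
    forall y : algHom (xring X) iota, transport x y (x \o D) =1 y \o D).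
Proof.
have d_const c : d (kappa c) = 0.
  have : (range kappa) (kappa c) by exists c.
  by rewrite K_constants.
have x_lin := point_linear_along x.
have [r [_ rK]] := spread_retraction x.
have spread_inj := can_inj rK.
(* Thus [x \o D] determines [spread x \o D], and injectivity of [spread x] recovers [D]. *)
have spreadD D : differential_torsor d D ->
    spread iota x \o D =1 spread iota (x \o D).
  move=> D_diff f; apply/esym.
  exact: (act_differential d_const (algHom_comp _ x) (generic_point kappa G iota)).
split; last by move=> D D_diff y; apply: transport_differential.
split=> [D D_diff|D D' /set_mem D_diff /set_mem D'_diff E|dt [dt_der dt_equiv]].
- split; first exact: differential_point_derivation.
  by move=> tau; apply: (transport_differential d_const (galois_point tau x)).
- apply/funext => f; apply: spread_inj.
  by rewrite [LHS](spreadD D D_diff) [RHS](spreadD D' D'_diff) E.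
have dt_lin := point_derivation_linear_along d_const dt_der.
have [dtB dtF dtM] := dt_der.
(* Descent supplies a preimage of [spread dt f] under [spread x]. It is unique, so the laws of a
   derivation can be checked after applying [spread x]. *)
pose D f := sval (cid (spread_equivariant charF0 Fbar_algebraic d_const dt_der dt_equiv f)).
have DE f : spread iota x (D f) = spread iota dt f by rewrite /D; case: cid.
have [tB _] := spread_linear_along dt_lin.
have tM f1 f2 : spread iota dt (f1 * f2) =
    spread iota x f1 * spread iota dt f2 + spread iota x f2 * spread iota dt f1.
  rewrite /spread /act /comp rmorphM.
  apply: (copair_derivation
    (s := tens_inl (iota \o kappa) (in_alg (gring G)) \o (iota \o kappa))).
  - exact: linear_along_comp.
  - exact: linear_along_comp.
  - exact: algHom_scalar (generic_point kappa G iota).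
  - by move=> a b; rewrite /= dtM rmorphD !rmorphM.
have spreadM f1 f2 : spread iota x (f1 * f2) = spread iota x f1 * spread iota x f2.
  exact: (rmorphM (spread_point x)).
have spread_scalar c : spread iota x c%:A = tens_inl _ _ (iota c).
  exact: (algHomE (spread_point x)).
have DB : zmod_morphism D.
  move=> f1 f2; apply: spread_inj.
  by rewrite DE tB -!DE; apply/esym/(rmorphB (spread_point x)).
have DM f1 f2 : D (f1 * f2) = D f1 * f2 + f1 * D f2.
  apply: spread_inj; rewrite DE tM -!DE -!spreadM -[RHS]/(spread_point x _).
  by rewrite addrC rmorphD [f2 * _]mulrC.
have DF c : D c%:A = (d c)%:A.
  apply: spread_inj; rewrite DE spread_scalar.
  have gs := algHom_scalar (generic_point kappa G iota).
  rewrite /spread /act /comp algHomE.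
  rewrite (linear_copairE (linear_along_comp _ dt_lin) gs).
  by rewrite /comp dtF rmorph1 mulr1.
(* Evaluation at the identity of [G] turns [DE] into the required equality of [x \o D] with [dt]. *)
exists D; last first.
  apply/funext => f.
  by rewrite /= -(spread_evaluation (D f) x_lin) DE spread_evaluation.
have D_lin : linear_along (in_alg (xring X) \o kappa) (in_alg (xring X) \o kappa) D.
  by split=> // c a; rewrite DM /= DF d_const scale0r mul0r add0r.
by split=> // f; exact: (spread_coact f D_lin dt_lin DE).
Qed.
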